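(* Consider the star graph probing problem with an arbitrary explicitly given patience distribution (defined in the context). There is an algorithm (computable in time polynomial in $n$ and the size of the description of the patience distribution) whose expected reward is at least $\tfrac12$ times the maximum expected reward achievable by any adaptive probing policy for this problem; i.e., it is a $1/2$-approximation.
   Context: Star graph probing problem with stochastic patience: there is a single online vertex $v$ and offline vertices $1,\dots,n$; offline vertex $j$ has weight $w_j\ge 0$ and probability $p_j\in[0,1]$. The patience of $v$ is a random positive integer $\Theta$ with explicitly given distribution; write $q_\theta=\Pr[\Theta\ge\theta]$, so $1=q_1\ge q_2\ge\dots\ge q_n$. A probing policy repeatedly (adaptively) selects an offline vertex not previously probed and probes it: the probe succeeds independently with probability $p_j$, in which case $v$ is matched to $j$, reward $w_j$ is collected, and the process stops. If the probe fails and the number of failed probes so far equals $\Theta$, the process stops with no further reward (the value of $\Theta$ is not known to the policy in advance; it is learned only when the patience is exhausted). The process also stops whenever the policy chooses to stop. The benchmark is the optimal such policy, which does not know the realization of $\Theta$ in advance. *)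

(* Defs.v *)
From HB Require Import structures.
From mathcomp Require Import all_boot all_order all_algebra.
Set Implicit Arguments.
Unset Strict Implicit.
Unset Printing Implicit Defensive.
Import Order.TTheory GRing.Theory Num.Theory.
Local Open Scope ring_scope.

(* * The star graph probing problem *)

(* [patience] lists pairs (theta, Pr[Theta = theta]).  A distribution with
   unbounded support is covered by passing to min(Theta, n), since at most n
   probes are ever made. *)
Record instance := Instance {
  nvert : nat;
  weight : 'I_nvert -> rat;
  prob : 'I_nvert -> rat;
  patience : seq (nat * rat);
  weight_ge0 : forall j, 0 <= weight j;
  prob_itv : forall j, 0 <= prob j <= 1;
  patience_uniq : uniq (unzip1 patience);
  patience_gt0 : all (fun t => (0 < t.1)%N) patience;
  patience_ge0 : all (fun t => 0 <= t.2) patience;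
  patience_sum1 : \sum_(t <- patience) t.2 = 1 }.

(* While the process is running, everything observed so far is the sequence h
   of vertices probed, all of them unsuccessfully.  [pi h (Some j)] is the
   probability that the policy now probes j, [pi h None] that it stops; so
   policies are adaptive and may be randomized. *)
Definition policy (R : Type) (n : nat) := seq 'I_n -> option 'I_n -> R.

Definition valid_policy (R : realFieldType) n (pi : policy R n) : Prop :=
  forall h : seq 'I_n,
    [/\ forall a, 0 <= pi h a,
        \sum_(a : option 'I_n) pi h a = 1
      & forall j, j \in h -> pi h (Some j) = 0].

(* Expected further reward after the failed probes h, when exactly k more
   failures exhaust the patience.  The policy sees h but not k. *)
Fixpoint reward_from (R : realFieldType) (I : instance)
    (pi : policy R (nvert I)) (k : nat) (h : seq 'I_(nvert I)) : R :=
  if k is k'.+1 then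
    \sum_(a : option 'I_(nvert I)) pi h a *
      (if a is Some j then
         ratr (prob j) * ratr (weight j)
         + (1 - ratr (prob j)) * reward_from pi k' (rcons h j)
       else 0)
  else 0.

Definition reward (R : realFieldType) (I : instance)
    (pi : policy R (nvert I)) : R :=
  \sum_(t <- patience I) ratr t.2 * reward_from pi t.1 [::].
Arguments reward {R} I pi.

(* The policy that probes the vertices listed in l, in this order. *)
Definition order_policy (R : realFieldType) n (l : seq nat) : policy R n :=
  fun h a => (a == obind insub (onth l (size h)))%:R.

(* * Algorithms: random access machine programs with logarithmic cost

   A memory cell holds a rational.  Evaluating an expression charges, at every
   node, one unit plus the bit size of the value found there, so that running
   times are polynomially related to those of Turing machines.  Rationals used
   as addresses, vertex numbers or sampling bounds are truncated to naturals. *)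

Definition bitsize (q : rat) : nat :=
  ((trunc_log 2 `|numq q|%N).+1 + (trunc_log 2 `|denq q|%N).+1)%N.

Inductive binop := Add | Sub | Mul | Div | Leq.

Inductive expr :=
  | Const of rat
  | Read of expr
  | Floor of expr
  | Bin of binop & expr & expr.

Inductive cmd :=
  | Skip
  | Store of expr & expr      (* address, value *)
  | Draw of expr & expr       (* address, m: a uniform sample of {0..m-1}, or 0 if m = 0 *)
  | Probe of expr
  | Seq of cmd & cmd
  | If of expr & cmd & cmd    (* a test holds when its value is nonzero *)
  | While of expr & cmd.

Definition memory := nat -> rat.

Definition eval_bin (o : binop) (x y : rat) : rat :=
  match o with
  | Add => x + y
  | Sub => x - y
  | Mul => x * y
  | Div => x / y
  | Leq => (x <= y)%R%:R
  end.

Fixpoint eval (m : memory) (e : expr) : rat :=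
  match e with
  | Const q => q
  | Read e1 => m (Num.truncn (eval m e1))
  | Floor e1 => (Num.floor (eval m e1))%:~R
  | Bin o e1 e2 => eval_bin o (eval m e1) (eval m e2)
  end.

Fixpoint cost (m : memory) (e : expr) : nat :=
  ((bitsize (eval m e)).+1 +
   match e with
   | Const _ => 0
   | Read e1 | Floor e1 => cost m e1
   | Bin _ e1 e2 => cost m e1 + cost m e2
   end)%N.

Definition update (m : memory) (i : nat) (q : rat) : memory :=
  fun j => if j == i then q else m j.

(* [probes] are the vertices probed so far, in order. *)
Record state := State { mem : memory; probes : seq nat; time : nat }.

Definition charge (t : nat) (s : state) : state :=
  State (mem s) (probes s) (t + time s).

(* Finitely supported distributions, as lists of (probability, outcome). *)
Definition dist (T : Type) := seq (rat * T).

Definition dret T (x : T) : dist T := [:: (1, x)].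

Definition dbind T U (d : dist T) (f : T -> dist U) : dist U :=
  flatten [seq [seq (x.1 * y.1, y.2) | y <- f x.2] | x <- d].

(* The outcome distribution of a command, as long as all the probes it makes
   fail and the patience lasts: a successful probe or the exhaustion of the
   patience ends the process, so the run is then merely cut short.  The bound k
   on the recursion depth is an artefact of the definition; the outcome is None
   when k is too small. *)
Fixpoint run (k : nat) (c : cmd) (s : state) : dist (option state) :=
  if k is k'.+1 then
    let andthen d c' :=
      dbind d (fun o => if o is Some s' then run k' c' s' else dret None) in
    match c with
    | Skip => dret (Some s)
    | Store ea ev =>
        dret (Some (State
          (update (mem s) (Num.truncn (eval (mem s) ea)) (eval (mem s) ev))
          (probes s) (cost (mem s) ea + cost (mem s) ev + time s)))
    | Draw ea em =>
        let b := (Num.truncn (eval (mem s) em)).-1.+1 in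
        [seq (b%:R^-1, Some (State
          (update (mem s) (Num.truncn (eval (mem s) ea)) i%:R)
          (probes s) (cost (mem s) ea + cost (mem s) em + time s)))
        | i <- iota 0 b]
    | Probe e =>
        dret (Some (State (mem s)
          (rcons (probes s) (Num.truncn (eval (mem s) e)))
          (cost (mem s) e + time s)))
    | Seq c1 c2 => andthen (run k' c1 s) c2
    | If e c1 c2 =>
        run k' (if eval (mem s) e != 0 then c1 else c2)
          (charge (cost (mem s) e) s)
    | While e c1 =>
        let s' := charge (cost (mem s) e) s in
        if eval (mem s) e != 0 then andthen (run k' c1 s') (While e c1)
        else dret (Some s')
    end
  else dret None.

Definition encode (I : instance) : seq rat :=
  (nvert I)%:R :: flatten [seq [:: weight j; prob j] | j <- enum 'I_(nvert I)]
  ++ (size (patience I))%:R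
     :: flatten [seq [:: t.1%:R; t.2] | t <- patience I].

Definition input_size (I : instance) : nat :=
  (\sum_(q <- encode I) bitsize q)%N.

Definition start (I : instance) : state :=
  State (nth 0 (encode I)) [::] 0.

Definition run_on (k : nat) (alg : cmd) (I : instance) : dist (option state) :=
  run k alg (start I).

(* Whatever the random samples, the run halts within time T, and it probes
   pairwise distinct vertices of the instance. *)
Definition proper_run (I : instance) (T : nat) (d : dist (option state)) : bool :=
  all (fun x => if x.2 is Some s then
         [&& (time s <= T)%N, uniq (probes s)
           & all (fun v => (v < nvert I)%N) (probes s)]
       else false) d.

Definition run_reward (R : realFieldType) (I : instance)
    (d : dist (option state)) : R :=
  \sum_(x <- d)
    ratr x.1 * (if x.2 is Some s
                then reward I (order_policy R (probes s)) else 0).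

(* Main.v *)
Require Import Defs.
From Stdlib Require Import FunctionalExtensionality.
From mathcomp Require Import all_boot all_order all_algebra.
From mathcomp Require Import zify ring lra.
Set Implicit Arguments.
Unset Strict Implicit.
Unset Printing Implicit Defensive.
Import Order.TTheory GRing.Theory Num.Theory.
Local Open Scope ring_scope.

(* Write q_a = Pr[Theta >= a].  Numbers U_a >= 0 and prices lam_j >= 0 with
   U_a >= p_j q_a w_j + (1 - p_j) U_(a+1) - lam_j for all a and j certify, by
   backward induction on the probes made, that no policy earns more than
   U_1 + sum_j lam_j.  Treat the positions a = n, ..., 1 in turn: if the largest
   gain p_j (q_a w_j - U) - lam_j is positive, attained at j = b, add it to both
   U and lam_b and place b at position a, withdrawing it from its former position
   if it had one.  This keeps the certificate valid and sum_j lam_j = U, so the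
   optimum is at most 2 U_1.  The final order earns at least U_1: every
   subsequence earns at least the sum S <= U of its prices, since b followed by
   it earns at least p_b q_a w_b + (1 - p_b) S >= S + p_b (q_a w_b - U). *)

(** * The greedy order and its value *)

Section Greedy.
Variable I : instance.
Let n := nvert I.
Implicit Types (j b : 'I_n) (l s : seq 'I_n) (U : rat) (lam stamp : nat -> rat).

Definition survival (a : nat) : rat :=
  \sum_(t <- patience I | (a <= t.1)%N) t.2.

(** The reward of probing [l] in order from position [a] on. Survival probabilities are
    unconditional, so a failed probe contributes only the factor [1 - prob j]. *)
Fixpoint order_value (a : nat) (l : seq 'I_n) : rat :=
  if l is j :: l' then
    prob j * (survival a * weight j) + (1 - prob j) * order_value a.+1 l'
  else 0.

(** The violation of the certificate inequality at position [a] for [j] when [U] is carried over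
    unchanged from position [a + 1]. *)
Definition gain (a : nat) U lam (j : 'I_n) : rat :=
  prob j * (survival a * weight j - U) - lam j.

(* The positions above the first argument have been treated.  The stamp of an
   item placed at position a is n + 1 - a, and 0 means never placed. *)
Inductive greedy : nat -> rat -> (nat -> rat) -> (nat -> rat) -> seq 'I_n -> Prop :=
  | greedy_start : greedy n 0 (fun=> 0) (fun=> 0) [::]
  | greedy_keep th U lam stamp l :
      greedy th.+1 U lam stamp l -> (forall j, gain th.+1 U lam j <= 0) ->
      greedy th U lam stamp l
  | greedy_take th U lam stamp l b :
      greedy th.+1 U lam stamp l ->
      (forall j, gain th.+1 U lam j <= gain th.+1 U lam b) ->
      0 < gain th.+1 U lam b ->
      greedy th (U + gain th.+1 U lam b)
        (update lam b (lam b + gain th.+1 U lam b))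
        (update stamp b (n - th)%:R) (b :: [seq j <- l | j != b]).

Lemma patience_item_ge0 t : t \in patience I -> 0 <= t.2.
Proof. by move/(allP (patience_ge0 I)). Qed.

Lemma survival_antitone a c : (a <= c)%N -> survival c <= survival a.
Proof.
move=> ac; rewrite /survival big_mkcond [leRHS]big_mkcond /= big_seq [leRHS]big_seq.
apply: ler_sum => t /patience_item_ge0 t0.
by case: (leqP c t.1) => [/(leq_trans ac) ->|_] //; case: ifP.
Qed.

Lemma survival_le1 a : survival a <= 1.
Proof.
rewrite -(patience_sum1 I) /survival big_mkcond big_seq [leRHS]big_seq /=.
by apply: ler_sum => t /patience_item_ge0 t0; case: ifP.
Qed.

Lemma prob_ge0 j : 0 <= prob j. Proof. by case/andP: (prob_itv j). Qed.

Lemma prob_le1 j : prob j <= 1. Proof. by case/andP: (prob_itv j). Qed.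

Lemma order_value_antitone a l : order_value a.+1 l <= order_value a l.
Proof.
elim: l a => //= j l IH a; apply: lerD.
  by rewrite ler_wpM2l ?prob_ge0 // ler_wpM2r ?weight_ge0 // survival_antitone.
by rewrite ler_wpM2l ?IH // subr_ge0 prob_le1.
Qed.

Lemma greedy_leq th U lam stamp l : greedy th U lam stamp l -> (th <= n)%N.
Proof. by elim=> // *; apply: ltnW. Qed.

Lemma greedy_lam_ge0 th U lam stamp l :
  greedy th U lam stamp l -> forall i, 0 <= lam i.
Proof.
elim=> // {th U lam stamp l} th U lam stamp l b _ IH _ g0 i.
by rewrite /update; case: ifP => // _; rewrite addr_ge0 // ltW.
Qed.

Lemma sum_update lam b x :
  \sum_(j < n) update lam b (lam b + x) j = \sum_(j < n) lam j + x.
Proof.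
rewrite (bigD1 b) //= [in RHS](bigD1 b) //= {1}/update eqxx -!addrA; congr (_ + _).
rewrite addrC; congr (_ + _); apply: eq_bigr => j jb.
by rewrite /update (inj_eq val_inj) (negPf jb).
Qed.

Lemma greedy_sum th U lam stamp l :
  greedy th U lam stamp l -> \sum_(j < n) lam j = U.
Proof.
elim=> // {th U lam stamp l} [|th U lam stamp l b _ IH _ _]; first exact: big1.
by rewrite sum_update IH.
Qed.

Lemma greedy_U_ge0 th U lam stamp l : greedy th U lam stamp l -> 0 <= U.
Proof.
by move=> G; rewrite -(greedy_sum G) sumr_ge0 // => j _; apply: greedy_lam_ge0 G _.
Qed.

(** The left side is [prob j * (survival a * weight j - U)], and [U] is nonnegative. Hence prices
    never exceed weights, which later bounds their bit size. *)
Lemma gain_le_weight th U lam stamp l a j :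
  greedy th U lam stamp l -> lam j + gain a U lam j <= weight j.
Proof.
move=> /greedy_U_ge0 U0; rewrite /gain addrC subrK.
have le1 : survival a * weight j <= weight j.
  by rewrite ler_piMl ?weight_ge0 // survival_le1.
have := ler_wpM2l (prob_ge0 j) le1.
have := ler_piMl (weight_ge0 j) (prob_le1 j).
have := mulr_ge0 (prob_ge0 j) U0; rewrite mulrBr; lra.
Qed.

Lemma greedy_lam_le th U lam stamp l :
  greedy th U lam stamp l -> forall j, lam j <= weight j.
Proof.
elim=> // {th U lam stamp l} [j|th U lam stamp l b G IH _ _ j].
  exact: weight_ge0.
rewrite /update; case: eqP => // /val_inj ->.
exact: gain_le_weight G.
Qed.

Lemma greedy_uniq th U lam stamp l : greedy th U lam stamp l -> uniq l.
Proof.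
elim=> // {th U lam stamp l} th U lam stamp l b _ Ul _ _ /=.
by rewrite filter_uniq // mem_filter eqxx.
Qed.

(** An item leaves the order only to be placed again, so every priced item stays in it and the
    prices along the order add up to [U]. *)
Lemma greedy_supp th U lam stamp l :
  greedy th U lam stamp l -> forall i, i \notin map val l -> lam i = 0.
Proof.
elim=> // {th U lam stamp l} th U lam stamp l b G IH _ _ i /=.
rewrite inE /update negb_or => /andP[ib il]; rewrite (negPf ib) IH //.
apply: contra il => /mapP[j jl ij]; apply/mapP; exists j => //.
by rewrite mem_filter jl andbT; apply: contraNneq ib => <-; rewrite ij.
Qed.

Lemma greedy_sum_seq_le th U lam stamp l s :
  greedy th U lam stamp l -> uniq s -> \sum_(j <- s) lam j <= U.
Proof.
move=> G Us; rewrite -(greedy_sum G) big_uniq //= [leRHS](bigID (mem s)) /=.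
by rewrite lerDl sumr_ge0 // => j _; apply: greedy_lam_ge0 G _.
Qed.

(* The inequality is kept for all subsequences because an item chosen again is
   withdrawn from its old place in the order. *)
Lemma greedy_order_value th U lam stamp l :
  greedy th U lam stamp l ->
  forall s, subseq s l -> \sum_(j <- s) lam j <= order_value th.+1 s.
Proof.
elim=> {th U lam stamp l}
  [s|th U lam stamp l G IH _ s sl|th U lam stamp l b G IH _ g0 s].
- by rewrite subseq0 => /eqP->; rewrite big_nil.
- exact: le_trans (IH s sl) (order_value_antitone _ _).
set l' := [seq j <- l | j != b]; set lam' := update _ _ _.
have l'l : subseq l' l by apply: filter_subseq.
have lamE s' : subseq s' l' -> \sum_(j <- s') lam' j = \sum_(j <- s') lam j.
  move=> s'l'; apply: eq_big_seq => j /(mem_subseq s'l').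
  by rewrite mem_filter /lam' /update (inj_eq val_inj) => /andP[/negPf->].
case: s => [|j s]; first by rewrite big_nil.
(* Either the subsequence starts with [b], or it avoids [b] and lies in the old order with its old
   prices. *)
rewrite [subseq _ _]/=; case: eqP => [->|_] sl'; last first.
  rewrite lamE //; apply: le_trans (order_value_antitone _ _).
  by apply: IH; apply: subseq_trans l'l.
rewrite big_cons lamE // {1}/lam' /update eqxx /=.
have sl := subseq_trans sl' l'l.
have IHs := IH _ sl.
have sU := greedy_sum_seq_le G (subseq_uniq sl (greedy_uniq G)).
have p1 : 0 <= 1 - prob b by rewrite subr_ge0 prob_le1.
have h1 := ler_wpM2l p1 IHs.
have h2 := ler_wpM2l (prob_ge0 b) sU.
rewrite /gain; rewrite !mulrBl !mul1r in h1; move: h1 h2; rewrite mulrBl mulrBr.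
lra.
Qed.

Lemma greedy_value U lam stamp l :
  greedy 0 U lam stamp l -> U <= order_value 1 l.
Proof.
move=> G; apply: le_trans (greedy_order_value G (subseq_refl l)).
rewrite -(greedy_sum G) [leRHS]big_uniq ?(greedy_uniq G) //=.
rewrite [leLHS](bigID (mem l)) /= gerDl sumr_le0 // => j jl.
by rewrite (greedy_supp G) // (mem_map val_inj).
Qed.

(** * Reading the order off the stamps *)

(** The program keeps no list: a new stamp overwrites the old one, which withdraws the item from its
    former position. Items are scanned in decreasing order because the loops of the program count
    down. *)
Fixpoint schedule stamp (k : nat) : seq 'I_n :=
  if k is k'.+1
  then [seq j : 'I_n <- rev (enum 'I_n) | stamp j == k%:R] ++ schedule stamp k'
  else [::].

(** Only stamps up to [k] are scanned, so the larger new stamp merely hides [b]. *)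
Lemma schedule_update stamp b k k' :
  (k < k')%N ->
  schedule (update stamp b k'%:R) k = [seq j <- schedule stamp k | j != b].
Proof.
elim: k => //= k IH kk'; rewrite filter_cat IH ?(ltnW kk') //; congr (_ ++ _).
rewrite -filter_predI; apply: eq_filter => j /=; rewrite /update (inj_eq val_inj).
by case: (j =P b) => //= _; rewrite eqr_nat gtn_eqF.
Qed.

Lemma greedy_stamp_le th U lam stamp l :
  greedy th U lam stamp l -> forall i, exists2 k, (k <= n - th)%N & stamp i = k%:R.
Proof.
elim=> {th U lam stamp l} [i|th U lam stamp l G IH _ i|th U lam stamp l b G IH _ _ i].
- by exists 0.
- by have [k kn ->] := IH i; exists k => //; lia.
rewrite /update; case: ifP => _; first by exists (n - th)%N.
by have [k kn ->] := IH i; exists k => //; lia.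
Qed.

Lemma greedy_schedule th U lam stamp l :
  greedy th U lam stamp l -> schedule stamp (n - th) = l.
Proof.
(* The stamps in use are at most [n - th'.+1], so [n - th'] is fresh: its level is empty after a
   skipped position and holds [b] alone after a placement. *)
have above th' U' lam' stamp' l' : greedy th'.+1 U' lam' stamp' l' ->
    forall j : 'I_n, (stamp' j == (n - th')%:R) = false.
  move=> G j; have := greedy_leq G.
  have [k kn -> thn] := greedy_stamp_le G j.
  by rewrite eqr_nat; lia.
elim=> {th U lam stamp l} [|th U lam stamp l G IH _|th U lam stamp l b G IH _ _].
- by rewrite subnn.
- have E : (n - th = (n - th.+1).+1)%N by have := greedy_leq G; lia.
  rewrite E /= IH -[RHS]cat0s; congr (_ ++ _).
  rewrite -(@filter_pred0 _ (rev (enum 'I_n))); apply: eq_filter => j.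
  by have := above _ _ _ _ _ G j; rewrite E.
have E : (n - th = (n - th.+1).+1)%N by have := greedy_leq G; lia.
rewrite E /= schedule_update // IH -[RHS]cat1s; congr (_ ++ _).
rewrite (@eq_filter _ _ (pred1 b)) => [|j /=]; last first.
  rewrite /update (inj_eq val_inj); case: (j =P b) => _; first by rewrite eqxx.
  by rewrite -E; apply: above G j.
by rewrite filter_pred1_uniq // ?rev_uniq ?enum_uniq // mem_rev mem_enum.
Qed.

End Greedy.

(** * Upper bound on the reward of every policy *)

Section PolicyBound.
Variables (I : instance) (R : realFieldType) (pi : policy R (nvert I)).
Hypothesis pi_valid : valid_policy pi.
Let n := nvert I.
Implicit Types (h : seq 'I_n) (j : 'I_n) (U : rat) (lam : nat -> rat).

(** Not conditioned on the patience outlasting [h]: by truncated subtraction, patience values at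
    most [size h] contribute no reward. *)
Definition value_to_go h : R :=
  \sum_(t <- patience I) ratr t.2 * reward_from pi (t.1 - size h) h.

(** The Bellman equation. As the value is unconditional, the patience enters only through the
    survival factor on the immediate reward. *)
Lemma value_to_goE h :
  value_to_go h =
  \sum_(a : option 'I_n) pi h a *
    (if a is Some j then
       ratr (prob j * (survival I (size h).+1 * weight j))
       + ratr (1 - prob j) * value_to_go (rcons h j)
     else 0).
Proof.
rewrite /value_to_go.
transitivity (\sum_(t <- patience I) \sum_(a : option 'I_n) pi h a *
    (if a is Some j then
       (if (size h < t.1)%N then ratr t.2 else 0) * ratr (prob j * weight j)
       + ratr (1 - prob j) *
         (ratr t.2 * reward_from pi (t.1 - size (rcons h j)) (rcons h j)) else 0)).
  apply: eq_bigr => t _; case: ltnP => [ht|th].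
    rewrite -[(t.1 - size h)%N]prednK ?subn_gt0 // -subnS /= big_distrr /=.
    apply: eq_bigr => -[j|] _; last by rewrite !mulr0.
    by rewrite size_rcons rmorphM rmorphB rmorph1; ring.
  have -> : (t.1 - size h = 0)%N by apply/eqP; rewrite subn_eq0.
  rewrite /= mulr0 big1 // => -[j|] _; last by rewrite mulr0.
  have -> : (t.1 - size (rcons h j) = 0)%N.
    by apply/eqP; rewrite subn_eq0 size_rcons ltnW.
  by rewrite /= !mulr0 mul0r addr0 mulr0.
rewrite exchange_big /=; apply: eq_bigr => -[j|] _; last first.
  by rewrite mulr0 big1 // => t _; rewrite mulr0.
rewrite -big_distrr /= big_split /= -!big_distrr -big_distrl /=; congr (_ * (_ + _)).
rewrite [in RHS]mulrCA [in RHS]rmorphM; congr (_ * _).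
by rewrite /survival rmorph_sum [RHS]big_mkcond.
Qed.

Lemma value_to_go_full h : uniq h -> size h = n -> value_to_go h = 0.
Proof.
move=> Uh hn; rewrite value_to_goE big1 // => -[j|] _; last by rewrite mulr0.
have [_ _ -> ] := pi_valid h; first by rewrite mul0r.
have hsub : {subset h <= enum 'I_n} by move=> i _; rewrite mem_enum.
have [|_ ->] := uniq_min_size Uh hsub; last by rewrite mem_enum.
by rewrite size_enum_ord hn.
Qed.

(** The backward step for both cases of [greedy]. With [q] the survival probability, the gain bound
    says [prob j * q * weight j + (1 - prob j) * U <= U' + lam j], and the price of [j] leaves the
    sum once [j] is probed. *)
Lemma value_to_go_step th U lam U' lam' h :
  (forall i, 0 <= lam i) -> (forall i, lam i <= lam' i) -> U <= U' ->
  (forall j, @gain I th.+1 U lam j <= U' - U) ->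
  (forall h, uniq h -> size h = th.+1 ->
     value_to_go h <= ratr (U + \sum_(j < n | j \notin h) lam j)) ->
  uniq h -> size h = th ->
  0 <= U ->
  value_to_go h <= ratr (U' + \sum_(j < n | j \notin h) lam' j).
Proof.
move=> lam0 lamle UU' gainle IH Uh hth U0.
have [pi0 pi1 pih] := pi_valid h.
(* The action probabilities sum to 1, so the bound is averaged over the actions and checked for each
   one. *)
rewrite value_to_goE -[leRHS]mul1r -pi1 big_distrl /=; apply: ler_sum => a _.
have S0 P : 0 <= \sum_(j < n | P j) lam' j.
  by apply: sumr_ge0 => j _; apply: le_trans (lam0 j) (lamle j).
case: a => [j|]; last first.
  by rewrite ler_wpM2l ?pi0 // ler0q addr_ge0 // (le_trans U0).
have [/pih->|jh] := boolP (j \in h); first by rewrite !mul0r.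
rewrite ler_wpM2l ?pi0 // hth.
have := IH (rcons h j); rewrite rcons_uniq jh Uh size_rcons hth => /(_ isT erefl) V.
have p1 : 0 <= 1 - prob j by rewrite subr_ge0 prob_le1.
have := ler_wpM2l (_ : 0 <= ratr (1 - prob j) :> R) V; rewrite ler0q => /(_ p1) V'.
apply: le_trans (lerD (lexx _) V') _; rewrite -rmorphM -rmorphD ler_rat.
have sumE (mu : nat -> rat) : \sum_(i < n | i \notin h) mu i =
    mu j + \sum_(i < n | i \notin rcons h j) mu i.
  rewrite (bigD1 j) //=; congr (_ + _); apply: eq_bigl => i.
  by rewrite mem_rcons inE negb_or andbC.
rewrite sumE; set S := \sum_(i < n | _) lam i; set S' := \sum_(i < n | _) lam' i.
have SS' : S <= S' by apply: ler_sum => i _.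
have S0' : 0 <= S by apply: sumr_ge0 => i _.
have := gainle j; have := lamle j; rewrite /gain.
have := mulr_ge0 (prob_ge0 j) S0'.
rewrite !mulrBr !mulrDr !mulrBl; lra.
Qed.

Lemma greedy_value_to_go th U lam stamp (l : seq 'I_(nvert I)) :
  greedy th U lam stamp l -> forall h, uniq h -> size h = th ->
  value_to_go h <= ratr (U + \sum_(j < n | j \notin h) lam j).
Proof.
elim=> {th U lam stamp l}
  [h Uh hn|th U lam stamp l G IH g h Uh hth|th U lam stamp l b G IH g g0 h Uh hth].
- by rewrite value_to_go_full // ler0q big1.
- apply: value_to_go_step IH Uh hth (greedy_U_ge0 G) => //.
    exact: greedy_lam_ge0 G.
  by move=> j; rewrite subrr.
apply: value_to_go_step IH Uh hth (greedy_U_ge0 G) => //.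
- exact: greedy_lam_ge0 G.
- by move=> i; rewrite /update; case: eqP => // ->; rewrite lerDl ltW.
- by rewrite lerDl ltW.
- by move=> j; rewrite addrAC subrr add0r.
Qed.

(** Before any probe the certificate is worth [U] plus all prices, that is [2 * U]. *)
Lemma greedy_reward_le U lam stamp (l : seq 'I_(nvert I)) :
  greedy 0 U lam stamp l -> 2^-1 * reward I pi <= ratr U.
Proof.
move=> G; have := greedy_value_to_go G (h := [::]) isT erefl.
rewrite (greedy_sum G) rmorphD /= -/(reward I pi).
have -> : value_to_go [::] = reward I pi.
  by apply: eq_bigr => t _; rewrite subn0.
lra.
Qed.

End PolicyBound.

(** * Reward of a fixed probing order *)

Lemma nth_obind_insub n (l : seq 'I_n) i :
  obind insub (onth (map val l) i) = onth l i :> option 'I_n.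
Proof.
by rewrite onth_map; case: (onth l i) => //= j; rewrite valK.
Qed.

(** The policy depends on the full list, so the induction generalizes over the prefix [h] already
    probed. The next action is certain, and the Bellman equation becomes the recursion of
    [order_value]. *)
Lemma order_value_to_go (I : instance) (R : realFieldType) h (l : seq 'I_(nvert I)) :
  value_to_go (order_policy R (map val (h ++ l))) h =
  ratr (order_value (size h).+1 l).
Proof.
elim: l h => [|j l IH] h.
  rewrite value_to_goE cats0 rmorph0 big1 // => -[j|] _; last by rewrite mulr0.
  rewrite /order_policy nth_obind_insub onth_default ?mul0r //.
rewrite value_to_goE (bigD1 (Some j)) //= [X in _ + X]big1 => [|a aj].
  rewrite addr0 /order_policy nth_obind_insub.
  have -> : onth (h ++ j :: l) (size h) = Some j.
    by rewrite onth_cat ltnn subnn.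
  rewrite eqxx mul1r -cat_rcons -/(order_policy _ _) IH size_rcons.
  by rewrite [in RHS]rmorphD [in RHS](rmorphM _ (1 - _)).
rewrite /order_policy nth_obind_insub.
have -> : onth (h ++ j :: l) (size h) = Some j.
  by rewrite onth_cat ltnn subnn.
by rewrite (negPf aj) mul0r.
Qed.

Lemma reward_order_policy (I : instance) (R : realFieldType) (l : seq 'I_(nvert I)) :
  reward I (order_policy R (map val l)) = ratr (order_value 1 l).
Proof.
rewrite -(order_value_to_go R [::] l).
by apply: eq_bigr => t _; rewrite subn0.
Qed.

(** * Bit sizes *)

Lemma trunc_log_lt k v : (0 < k)%N -> (v < 2 ^ k)%N -> (trunc_log 2 v < k)%N.
Proof.
case: v => [|v]; first by rewrite trunc_log0.
move=> _ vk; rewrite ltnNge; apply/negP => /(leq_pexp2l (isT : 0 < 2)%N) kv.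
by have := leq_trans kv (trunc_logP (isT : 1 < 2)%N (isT : 0 < v.+1)%N); lia.
Qed.

Lemma bitsize_num_den (q : rat) : exists a b : nat,
  [/\ (0 < a)%N, (0 < b)%N, (`|numq q| < 2 ^ a)%N, (`|denq q| < 2 ^ b)%N
    & bitsize q = (a + b)%N].
Proof.
exists (trunc_log 2 `|numq q|%N).+1, (trunc_log 2 `|denq q|%N).+1.
by split; rewrite ?trunc_log_ltn.
Qed.

Lemma frac_num_den (a b : int) : b != 0 ->
  (`|numq (a%:Q / b%:Q)| <= `|a|)%N /\ (`|denq (a%:Q / b%:Q)| <= `|b|)%N.
Proof.
case: divqP => // k x k0 _; rewrite !abszM.
by split; rewrite leq_pmull // absz_gt0.
Qed.

Lemma bitsize_frac (a b : int) (k l : nat) : b != 0 -> (0 < k)%N -> (0 < l)%N ->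
  (`|a| < 2 ^ k)%N -> (`|b| < 2 ^ l)%N -> (bitsize (a%:Q / b%:Q) <= k + l)%N.
Proof.
move=> b0 k0 l0 ak bl; have [na db] := frac_num_den a b0.
by rewrite leq_add // trunc_log_lt //; [apply: leq_ltn_trans ak|apply: leq_ltn_trans bl].
Qed.

Lemma bitsize_ge2 q : (2 <= bitsize q)%N.
Proof. by rewrite /bitsize addSn addnS. Qed.

Lemma bitsizeN q : bitsize (- q) = bitsize q.
Proof. by rewrite /bitsize numqN denqN abszN. Qed.

Lemma bitsizeM x y : (bitsize (x * y) <= 2 * (bitsize x + bitsize y))%N.
Proof.
have [a [b [a0 b0 xa xb ->]]] := bitsize_num_den x.
have [c [d [c0 d0 yc yd ->]]] := bitsize_num_den y.
have -> : x * y = (numq x * numq y)%:Q / (denq x * denq y)%:Q.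
  by rewrite !rmorphM /= invfM mulrACA !divq_num_den.
apply: (@leq_trans ((a + c) + (b + d))); last lia.
apply: bitsize_frac; rewrite ?mulf_neq0 ?denq_neq0 ?addn_gt0 ?a0 ?b0 //.
- by rewrite abszM expnD ltn_mul.
- by rewrite abszM expnD ltn_mul.
Qed.

Lemma bitsizeD x y : (bitsize (x + y) <= 2 * (bitsize x + bitsize y))%N.
Proof.
have [a [b [a0 b0 xa xb ->]]] := bitsize_num_den x.
have [c [d [c0 d0 yc yd ->]]] := bitsize_num_den y.
have -> : x + y = (numq x * denq y + numq y * denq x)%:Q / (denq x * denq y)%:Q.
  rewrite -[x in LHS]divq_num_den -[y in LHS]divq_num_den rmorphD !rmorphM /=.
  by field; rewrite !intr_eq0 !denq_neq0.
apply: (@leq_trans ((a + d + (c + b)) + (b + d))); last lia.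
apply: bitsize_frac; rewrite ?mulf_neq0 ?denq_neq0 ?addn_gt0 ?a0 ?b0 //.
- have abszD (p q : int) : (`|(p + q)%R| <= `|p| + `|q|)%N by lia.
  apply: leq_ltn_trans (abszD _ _) _; rewrite !abszM expnD.
  (* As [u] and [v] are at least 2, numbers below [u] and [v] have a sum below [u * v]. *)
  set u := (2 ^ (a + d))%N; set v := (2 ^ (c + b))%N.
  have u2 : (2 <= u)%N by rewrite /u -{1}[2%N]expn1 leq_pexp2l // addn_gt0 a0.
  have v2 : (2 <= v)%N by rewrite /v -{1}[2%N]expn1 leq_pexp2l // addn_gt0 c0.
  have : (`|numq x| * `|denq y| < u)%N by rewrite /u expnD ltn_mul.
  have : (`|numq y| * `|denq x| < v)%N by rewrite /v expnD ltn_mul.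
  by nia.
- by rewrite abszM expnD ltn_mul.
Qed.

Lemma bitsize_bool (b : bool) : bitsize b%:R = 2%N.
Proof. by case: b. Qed.

(** A denominator dividing [D ^ k] and a bound on [x] control the size linearly in [k]. Iterating
    [bitsizeD] and [bitsizeM] would give a bound exponential in the number of operations. *)
Lemma bitsize_grain (D k L M : nat) (x : rat) :
  (0 < D)%N -> (D <= 2 ^ L)%N ->
  D%:R ^+ k * x \is a Num.int -> `|x| <= (2 ^ M)%:R ->
  (bitsize x <= M + L * k + L * k + 2)%N.
Proof.
move=> D0 DL /intrP[a ax] xM.
have Dk0 : D%:R ^+ k != 0 :> rat by rewrite expf_neq0 // pnatr_eq0 -lt0n.
have DkL : (D ^ k <= 2 ^ (L * k))%N
  by rewrite expnM; elim: (k) => // i IH; rewrite !expnS leq_mul.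
have -> : x = a%:Q / ((D ^ k)%:Z)%:Q.
  by rewrite -ax -[((D ^ k)%:Z)%:Q]/((D ^ k)%:R) natrX mulrC mulKf.
apply: (@leq_trans ((M + L * k).+1 + (L * k).+1)); last lia.
apply: bitsize_frac => //.
- by rewrite -lt0n expn_gt0 D0.
- rewrite expnS expnD.
  suff : (`|a|%N <= 2 ^ M * D ^ k)%N.
    by have : (0 < 2 ^ M * 2 ^ (L * k))%N; [rewrite muln_gt0 !expn_gt0|nia].
  rewrite -(ler_nat rat) natr_absz natrM intr_norm -ax normrM mulrC.
  by rewrite normrX normr_nat [(D ^ k)%:R]natrX ler_wpM2r // exprn_ge0.
- by rewrite expnS /=; have : (0 < 2 ^ (L * k))%N; [rewrite expn_gt0|lia].
Qed.

Lemma bitsize_nat (k L : nat) : (k <= L)%N -> (bitsize k%:R <= L + 2)%N.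
Proof.
move=> kL; have := @bitsize_grain 1 0 0 L k%:R isT isT.
rewrite expr0 mul1r rpred_nat normr_nat ler_nat !mul0n !addn0; apply=> //.
by apply: leq_trans kL _; apply: ltnW; apply: ltn_expl.
Qed.

(** * Cost of expressions and commands *)

(** The fragment in which the program is written: ring operations and comparisons, for which sizes
    are bounded. *)
Fixpoint div_free (e : expr) : bool :=
  match e with
  | Const _ => true
  | Read e1 => div_free e1
  | Floor _ | Bin Div _ _ => false
  | Bin _ e1 e2 => div_free e1 && div_free e2
  end.

(** A factor by which evaluating a [div_free] expression can enlarge the cell size; the 2 is that of
    [bitsizeD] and [bitsizeM]. It depends on the syntax alone, not on the instance. *)
Fixpoint ebits (e : expr) : nat :=
  match e with
  | Const q => bitsize q
  | Read _ | Floor _ => 1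
  | Bin _ e1 e2 => 2 * (ebits e1 + ebits e2)
  end.

Fixpoint ecost (e : expr) : nat :=
  ((ebits e).+1 +
   match e with
   | Const _ => 0
   | Read e1 | Floor e1 => ecost e1
   | Bin _ e1 e2 => ecost e1 + ecost e2
   end)%N.

Section ExprCost.
Variables (B : nat) (m : memory).
Hypotheses (B_gt0 : (0 < B)%N) (mB : forall a, (bitsize (m a) <= B)%N).

Lemma bitsize_eval e : div_free e -> (bitsize (eval m e) <= ebits e * B)%N.
Proof.
elim: e => [q|e1 _|e1|o e1 IH1 e2 IH2] //=.
- by move=> _; rewrite leq_pmulr.
- by rewrite mul1n.
have ge2 := (bitsize_ge2 (eval m e1), bitsize_ge2 (eval m e2)).
case: o => //= /andP[/IH1{}IH1 /IH2{}IH2].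
- by apply: leq_trans (bitsizeD _ _) _; lia.
- by apply: leq_trans (bitsizeD _ _) _; rewrite bitsizeN; lia.
- by apply: leq_trans (bitsizeM _ _) _; lia.
- by rewrite bitsize_bool; have := ge2.1; lia.
Qed.

Lemma cost_le e : div_free e -> (cost m e <= ecost e * B)%N.
Proof.
elim: e => [q|e1 IH1|e1|o e1 IH1 e2 IH2] // df; have := bitsize_eval df; move: df.
- by rewrite /=; lia.
- by move=> /IH1 /=; lia.
- by case: o => //= /andP[/IH1{}IH1 /IH2{}IH2]; lia.
Qed.

End ExprCost.

(* ['X] stands for the number of iterations of a loop. *)
Fixpoint ccost (c : cmd) : {poly nat} :=
  match c with
  | Skip => 0
  | Store ea ev | Draw ea ev => (ecost ea + ecost ev)%:P
  | Probe e => (ecost e)%:P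
  | Seq c1 c2 => ccost c1 + ccost c2
  | If e c1 c2 => (ecost e)%:P + (ccost c1 + ccost c2)
  | While e c1 => 'X * ((ecost e)%:P + ccost c1) + (ecost e)%:P
  end.

(** * Deterministic runs *)

(** Asking for all large recursion bounds lets the bounds of two parts be combined by a maximum. *)
Definition runs (c : cmd) (s s' : state) : Prop :=
  exists k0, forall k, (k0 <= k)%N -> run k c s = dret (Some s').

Lemma dbind_dret T U (x : T) (f : T -> dist U) (y : U) :
  f x = dret y -> dbind (dret x) f = dret y.
Proof. by rewrite /dbind /= => -> /=; rewrite mul1r. Qed.

Lemma runs_skip s : runs Skip s s.
Proof. by exists 1%N => -[]. Qed.

Lemma runs_store ea ev s :
  runs (Store ea ev) s
    (State
       (update (Defs.mem s) (Num.truncn (eval (Defs.mem s) ea))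
          (eval (Defs.mem s) ev))
       (probes s) (cost (Defs.mem s) ea + cost (Defs.mem s) ev + time s)).
Proof. by exists 1%N => -[]. Qed.

Lemma runs_probe e s :
  runs (Probe e) s
    (State (Defs.mem s) (rcons (probes s) (Num.truncn (eval (Defs.mem s) e)))
       (cost (Defs.mem s) e + time s)).
Proof. by exists 1%N => -[]. Qed.

Lemma runs_seq c1 c2 s s1 s2 :
  runs c1 s s1 -> runs c2 s1 s2 -> runs (Seq c1 c2) s s2.
Proof.
move=> [k1 h1] [k2 h2]; exists (maxn k1 k2).+1 => -[//|k].
rewrite ltnS geq_max => /andP[l1 l2] /=.
by rewrite h1 //; apply: dbind_dret; apply: h2.
Qed.

Lemma runs_if e c1 c2 s s' :
  runs (if eval (Defs.mem s) e != 0 then c1 else c2)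
    (charge (cost (Defs.mem s) e) s) s' ->
  runs (If e c1 c2) s s'.
Proof. by move=> [k1 h1]; exists k1.+1 => -[//|k] /h1. Qed.

Lemma runs_while_stop e c s :
  eval (Defs.mem s) e = 0 -> runs (While e c) s (charge (cost (Defs.mem s) e) s).
Proof. by move=> e0; exists 1%N => -[//|k] _ /=; rewrite e0 eqxx. Qed.

Lemma runs_while_loop e c s s1 s2 :
  eval (Defs.mem s) e != 0 -> runs c (charge (cost (Defs.mem s) e) s) s1 ->
  runs (While e c) s1 s2 -> runs (While e c) s s2.
Proof.
move=> e0 [k1 h1] [k2 h2]; exists (maxn k1 k2).+1 => -[//|k].
rewrite ltnS geq_max => /andP[l1 l2] /=.
by rewrite e0 h1 //; apply: dbind_dret; apply: h2.
Qed.

(** * Bit sizes of the numbers met by the greedy algorithm *)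

(** The bound of [bitsize_grain] for [M = 2 * L] and [k = L + 3]. *)
Definition bit_bound (L : nat) : nat := (2 * L * L + 8 * L + 2)%N.

Section Numbers.
Variable I : instance.
Let n := nvert I.
Let L := input_size I.
Implicit Types (j : 'I_n) (t : nat * rat) (U : rat) (lam : nat -> rat).

Lemma mem_weight j : weight j \in encode I.
Proof.
rewrite inE mem_cat; apply/orP; right; apply/orP; left.
by apply/flatten_mapP; exists j; rewrite ?mem_enum ?inE ?eqxx.
Qed.

Lemma mem_prob j : prob j \in encode I.
Proof.
rewrite inE mem_cat; apply/orP; right; apply/orP; left.
by apply/flatten_mapP; exists j; rewrite ?mem_enum ?inE ?eqxx ?orbT.
Qed.

Lemma mem_patience t : t \in patience I -> t.2 \in encode I.
Proof.
move=> tI; rewrite inE mem_cat inE; apply/orP; right; apply/orP; right.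
apply/orP; right; apply/flatten_mapP; exists t => //.
by rewrite !inE eqxx orbT.
Qed.

Lemma size_flatten_pairs T (f g : T -> rat) (s : seq T) :
  size (flatten [seq [:: f x; g x] | x <- s]) = (2 * size s)%N.
Proof. by elim: s => //= x s ->; lia. Qed.

Lemma size_encode : size (encode I) = (2 * n + 2 * size (patience I) + 2)%N.
Proof.
rewrite /= size_cat /= !size_flatten_pairs size_enum_ord; lia.
Qed.

Lemma size_encode_le : (size (encode I) <= L)%N.
Proof.
rewrite /L /input_size -sum1_size; apply: leq_sum => q _.
exact: ltnW (bitsize_ge2 q).
Qed.

Lemma nvert_le : (n <= L)%N.
Proof. by have := size_encode_le; rewrite size_encode; lia. Qed.

Lemma size_patience_le : (size (patience I) <= L)%N.
Proof. by have := size_encode_le; rewrite size_encode; lia. Qed.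

Lemma bitsize_input q : q \in encode I -> (bitsize q <= L)%N.
Proof. by move=> qI; rewrite /L /input_size (big_rem q) //= leq_addr. Qed.

(** Bit sizes add up over the input, so this product is at most [2 ^ L]. *)
Definition common_den : nat := (\prod_(q <- encode I) `|denq q|)%N.

Lemma common_den_gt0 : (0 < common_den)%N.
Proof. by apply: prodn_gt0 => q; rewrite absz_gt0 denq_neq0. Qed.

Lemma common_den_le : (common_den <= 2 ^ L)%N.
Proof.
rewrite /common_den /L /input_size expn_sum; apply: leq_prod => q _.
have [a [b [_ _ _ qb ->]]] := bitsize_num_den q.
by apply: ltnW; apply: leq_trans qb _; rewrite leq_exp2l // leq_addl.
Qed.

Lemma grain_input q : q \in encode I -> common_den%:R * q \is a Num.int.
Proof.
move=> qI; rewrite /common_den (big_rem q) //= natrM mulrAC rpredM ?rpred_nat //.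
by rewrite natr_absz ger0_norm ?denq_ge0 // mulrC -numqE rpred_int.
Qed.

Lemma input_le q : q \in encode I -> q <= (2 ^ L)%:R.
Proof.
move=> /bitsize_input; have [a [b [a0 b0 qa qb ->]]] := bitsize_num_den q => abL.
apply: (@le_trans _ _ `|numq q|%N%:R).
  rewrite natr_absz.
  have d1 : 1 <= (denq q)%:~R :> rat by rewrite ler1z -gtz0_ge1 denq_gt0.
  have [q0|q0] := leP q 0; first by apply: le_trans q0 _; rewrite ler0z.
  by rewrite intr_norm numqE normrM !ger0_norm ?ler_peMr ?ler0z ?denq_ge0 // ltW.
rewrite ler_nat; apply: ltnW; apply: leq_trans qa _; rewrite leq_exp2l //; lia.
Qed.

Lemma bits_nat k : (k <= L)%N -> (bitsize k%:R <= bit_bound L)%N.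
Proof. by move=> kL; apply: leq_trans (bitsize_nat kL) _; rewrite /bit_bound; lia. Qed.

Lemma bits_input q : q \in encode I -> (bitsize q <= bit_bound L)%N.
Proof. by move=> /bitsize_input qL; rewrite /bit_bound; lia. Qed.

Lemma bits_grain k x :
  (k <= n + 3)%N -> common_den%:R ^+ k * x \is a Num.int ->
  0 <= x -> x <= (2 ^ (2 * L))%:R -> (bitsize x <= bit_bound L)%N.
Proof.
move=> kn xint x0 xL; have nL := nvert_le.
have := bitsize_grain common_den_gt0 common_den_le xint.
move=> /(_ (2 * L)%N); rewrite ger0_norm // => /(_ xL) h; apply: leq_trans h _.
rewrite /bit_bound; have : (L * k <= L * (L + 3))%N by rewrite leq_mul2l; lia.
lia.
Qed.

Definition tail_sum (a i : nat) : rat :=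
  \sum_(t <- drop i (patience I) | (a <= t.1)%N) t.2.

Lemma tail_sum_grain a i : common_den%:R * tail_sum a i \is a Num.int.
Proof.
rewrite /tail_sum mulr_sumr big_seq_cond rpred_sum // => t /andP[/mem_drop tI _].
by rewrite grain_input // mem_patience.
Qed.

Lemma survival_grain a : common_den%:R * survival I a \is a Num.int.
Proof. by have := tail_sum_grain a 0; rewrite /tail_sum drop0. Qed.

Lemma bits_tail_sum a i : (bitsize (tail_sum a i) <= bit_bound L)%N.
Proof.
apply: (@bits_grain 1); rewrite ?expr1 ?tail_sum_grain //; first by lia.
  rewrite /tail_sum big_seq_cond sumr_ge0 // => t /andP[/mem_drop tI _].
  exact: patience_item_ge0 tI.
apply: (@le_trans _ _ 1); last by rewrite (ler_nat _ 1) expn_gt0.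
apply: le_trans (survival_le1 I a).
rewrite /survival -[in leRHS](cat_take_drop i (patience I)) big_cat /= lerDr.
rewrite big_seq_cond sumr_ge0 // => t /andP[/mem_take tI _].
exact: patience_item_ge0 tI.
Qed.

(** Multiplying [U] by [prob j] costs one more factor of the common denominator; the fresh product
    of probability, survival and weight needs three factors, hence [1 < k]. *)
Lemma gain_grain k a U lam j :
  (1 < k)%N -> common_den%:R ^+ k * U \is a Num.int ->
  common_den%:R ^+ k * lam j \is a Num.int ->
  common_den%:R ^+ k.+1 * gain a U lam j \is a Num.int.
Proof.
move=> k1 Ui li.
have -> : common_den%:R ^+ k.+1 * gain a U lam j =
    (common_den%:R * prob j) *
      ((common_den%:R * survival I a) * (common_den%:R * weight j) *
         common_den%:R ^+ (k - 2) - common_den%:R ^+ k * U)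
    - common_den%:R * (common_den%:R ^+ k * lam j).
  by rewrite /gain -{1 3 4}(subnK k1) addn2 !exprS; ring.
have Di : common_den%:R \is a @Num.int rat by rewrite rpred_nat.
apply: rpredB; last exact: rpredM.
apply: rpredM; first by rewrite grain_input ?mem_prob.
apply: rpredB => //; apply: rpredM; last exact: rpredX.
by apply: rpredM; rewrite ?survival_grain ?grain_input ?mem_weight.
Qed.

Lemma grainW k k' (x : rat) : (k <= k')%N -> common_den%:R ^+ k * x \is a Num.int ->
  common_den%:R ^+ k' * x \is a Num.int.
Proof.
by move=> kk' xi; rewrite -(subnK kk') exprD -mulrA rpredM // rpredX // rpred_nat.
Qed.

(** Each treated position adds one factor; the offset 2 meets the condition of [gain_grain] at the
    first of them. *)
Lemma greedy_grain th U lam stamp (l : seq 'I_n) :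
  greedy th U lam stamp l ->
  common_den%:R ^+ (n - th + 2) * U \is a Num.int /\
  forall i, common_den%:R ^+ (n - th + 2) * lam i \is a Num.int.
Proof.
elim=> {th U lam stamp l}
  [|th U lam stamp l G [Ui li] _|th U lam stamp l b G [Ui li] _ _].
- by split=> *; rewrite mulr0 rpred0.
- by split=> *; apply: grainW (_ : n - th.+1 + 2 <= _)%N _ => //; lia.
have thn := greedy_leq G.
have E : (n - th + 2 = (n - th.+1 + 2).+1)%N by rewrite -/n in thn; lia.
have gi := gain_grain th.+1 (ltac:(lia) : (1 < n - th.+1 + 2)%N) Ui (li b).
rewrite E; split=> [|i].
  by rewrite mulrDr rpredD //; apply: grainW Ui.
rewrite /update; case: ifP => _; last by apply: grainW (li i).
by rewrite mulrDr rpredD //; apply: grainW (li b).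
Qed.

Lemma weight_le j : weight j <= (2 ^ (2 * L))%:R.
Proof.
apply: le_trans (input_le (mem_weight j)) _.
by rewrite ler_nat leq_exp2l //; lia.
Qed.

Lemma bits_U th U lam stamp (l : seq 'I_n) :
  greedy th U lam stamp l -> (bitsize U <= bit_bound L)%N.
Proof.
move=> G; have [Ui _] := greedy_grain G.
apply: bits_grain Ui (greedy_U_ge0 G) _; first by rewrite -/n; lia.
(* [U] is a sum of [n] prices, each at most [2 ^ L], and [n] is at most [2 ^ L]. *)
rewrite -(greedy_sum G); apply: (@le_trans _ _ (\sum_(j < n) (2 ^ L)%:R)).
  apply: ler_sum => j _; apply: le_trans (greedy_lam_le G j) _.
  exact: input_le (mem_weight j).
rewrite sumr_const card_ord -[_ *+ n]mulr_natr -natrM ler_nat mul2n -addnn expnD.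
by rewrite leq_mul2l (leq_trans nvert_le (ltnW (ltn_expl _ _))) ?orbT.
Qed.

Lemma bits_lam th U lam stamp (l : seq 'I_n) :
  greedy th U lam stamp l -> forall i, (bitsize (lam i) <= bit_bound L)%N.
Proof.
move=> G i; have [_ li] := greedy_grain G.
apply: bits_grain (li i) (greedy_lam_ge0 G i) _; first by rewrite -/n; lia.
have [il|il] := boolP (i \in map val l); last by rewrite (greedy_supp G il) ler0n.
have /mapP[j _ ->] := il.
by apply: le_trans (greedy_lam_le G j) (weight_le j).
Qed.

(** Only nonnegative gains are ever stored, and those are at most a weight. *)
Lemma bits_gain th U lam stamp (l : seq 'I_n) a j :
  greedy th U lam stamp l -> 0 <= gain a U lam j ->
  (bitsize (gain a U lam j) <= bit_bound L)%N.
Proof.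
move=> G g0; have [Ui li] := greedy_grain G.
have gi := gain_grain a (ltac:(lia) : (1 < n - th + 2)%N) Ui (li j).
apply: bits_grain gi g0 _; first by rewrite -/n; lia.
apply: le_trans (weight_le j); apply: le_trans (gain_le_weight a j G).
by rewrite lerDr (greedy_lam_ge0 G).
Qed.

End Numbers.

(** * The program *)

Definition lit (k : nat) : expr := Const k%:R.
Definition nE : expr := Read (lit 0).
Definition mE : expr := Read (Bin Add (lit 1) (Bin Mul (lit 2) nE)).

(* No fixed address is free, since the length of the input is unbounded: the
   registers are addressed relative to the end of the input. *)
Definition slot (e : expr) : expr :=
  Bin Add (Bin Add (Bin Add (Bin Mul (lit 2) nE) (Bin Mul (lit 2) mE)) (lit 2)) e.

Definition reg (k : nat) : expr := Read (slot (lit k)).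
Definition lam_at (e : expr) : expr := slot (Bin Add (lit 7) (Bin Mul (lit 2) e)).
Definition stamp_at (e : expr) : expr := slot (Bin Add (lit 8) (Bin Mul (lit 2) e)).
Definition weightE (e : expr) : expr := Read (Bin Add (lit 1) (Bin Mul (lit 2) e)).
Definition probE (e : expr) : expr := Read (Bin Add (lit 2) (Bin Mul (lit 2) e)).
Definition thetaE (e : expr) : expr :=
  Read (Bin Add (Bin Add (lit 2) (Bin Mul (lit 2) nE)) (Bin Mul (lit 2) e)).
Definition massE (e : expr) : expr :=
  Read (Bin Add (Bin Add (lit 3) (Bin Mul (lit 2) nE)) (Bin Mul (lit 2) e)).

Definition set_reg (k : nat) (e : expr) : cmd := Store (slot (lit k)) e.
Definition decr (k : nat) : cmd := set_reg k (Bin Defs.Sub (reg k) (lit 1)).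
(** The decrement comes first, so the body sees the indices from the initial value minus one down to
    0. *)
Definition countdown (k : nat) (c : cmd) : cmd := While (reg k) (Seq (decr k) c).

Definition gainE : expr :=
  Bin Defs.Sub
    (Bin Mul (probE (reg 2))
       (Bin Defs.Sub (Bin Mul (reg 5) (weightE (reg 2))) (reg 1)))
    (Read (lam_at (reg 2))).

Definition survival_loop : cmd :=
  countdown 6
    (If (Bin Leq (reg 0) (thetaE (reg 6)))
       (set_reg 5 (Bin Add (reg 5) (massE (reg 6)))) Skip).

(** [plan_step] starts register 3 at 0 and only a strict improvement changes it, so it ends nonzero
    exactly when some gain is positive; otherwise register 4 is stale. *)
Definition best_loop : cmd :=
  countdown 2
    (If (Bin Leq gainE (reg 3)) Skip
       (Seq (set_reg 3 gainE) (set_reg 4 (reg 2)))).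

(** Register 0 still holds the current position here, so the stamp is [n + 1] minus that
    position. *)
Definition take_best : cmd :=
  If (reg 3)
    (Seq (Store (lam_at (reg 4)) (Bin Add (Read (lam_at (reg 4))) (reg 3)))
    (Seq (Store (stamp_at (reg 4)) (Bin Defs.Sub (Bin Add nE (lit 1)) (reg 0)))
         (set_reg 1 (Bin Add (reg 1) (reg 3)))))
    Skip.

Definition plan_step : cmd :=
  Seq (set_reg 5 (lit 0)) (Seq (set_reg 6 mE) (Seq survival_loop
  (Seq (set_reg 3 (lit 0)) (Seq (set_reg 2 nE) (Seq best_loop
  (Seq take_best (decr 0))))))).

(** The caller lowers register 0 from [n] to 1, so the largest stamp, which belongs to the earliest
    position, is probed first; items of stamp 0 are never probed. *)
Definition probe_loop : cmd :=
  countdown 2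
    (If (Bin Defs.Sub (Read (stamp_at (reg 2))) (reg 0)) Skip (Probe (reg 2))).

Definition greedy_program : cmd :=
  Seq (set_reg 0 nE) (Seq (While (reg 0) plan_step)
  (Seq (set_reg 0 nE)
       (While (reg 0) (Seq (set_reg 2 nE) (Seq probe_loop (decr 0)))))).

(** * Memory layout *)

(* Contents of registers 0 to 6, followed by the interleaved arrays. *)
Record regs := Regs {
  r_pos : nat; r_total : rat; r_item : nat; r_gain : rat; r_best : nat;
  r_surv : rat; r_row : nat; r_lam : nat -> rat; r_stamp : nat -> rat }.

Definition scratch (r : regs) (a : nat) : rat :=
  match a with
  | 0 => (r_pos r)%:R
  | 1 => r_total r
  | 2 => (r_item r)%:R
  | 3 => r_gain r
  | 4 => (r_best r)%:R
  | 5 => r_surv r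
  | 6 => (r_row r)%:R
  | a'.+4.+3 => if odd a' then r_stamp r a'./2 else r_lam r a'./2
  end.

Section Layout.
Variable I : instance.
Let n := nvert I.
Let L := input_size I.
Let E := size (encode I).

(** Below [E] lies the input, which the program never overwrites; so a record determines the whole
    memory. *)
Definition layout (r : regs) : memory :=
  fun a => if (a < E)%N then nth 0 (encode I) a else scratch r (a - E).

Lemma layout_scratch r a : layout r (E + a)%N = scratch r a.
Proof. by rewrite /layout ltnNge leq_addr /= addKn. Qed.

Lemma update_layout r r' a v :
  update (scratch r) a v =1 scratch r' ->
  update (layout r) (E + a)%N v = layout r'.
Proof.
move=> rr'; apply: functional_extensionality => x; rewrite /layout -rr' /update.
case: (ltnP x E) => [xE|Ex]; first by rewrite ltn_eqF // (leq_trans xE) ?leq_addr.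
by rewrite -{1}(subnKC Ex) eqn_add2l.
Qed.

Lemma layout_start : Defs.mem (start I) = layout (Regs 0 0 0 0 0 0 0 (fun=> 0) (fun=> 0)).
Proof.
apply: functional_extensionality => a; rewrite /layout; case: ltnP => // Ea.
rewrite [LHS](nth_default _ Ea); move: (a - E)%N.
case=> [|[|[|[|[|[|[|k]]]]]]] //=.
by case: (odd k).
Qed.

Lemma nth_pairs T (x0 : T) (f g : T -> rat) (s : seq T) tl i : (i < size s)%N ->
  nth 0 (flatten [seq [:: f x; g x] | x <- s] ++ tl) (2 * i)%N = f (nth x0 s i) /\
  nth 0 (flatten [seq [:: f x; g x] | x <- s] ++ tl) (2 * i).+1 = g (nth x0 s i).
Proof.
elim: s i => //= x s IH [|i] //; rewrite ltnS => /IH.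
by rewrite mulnS !addSn add0n.
Qed.

Lemma nth_pairs_tail T (f g : T -> rat) (s : seq T) tl i :
  nth 0 (flatten [seq [:: f x; g x] | x <- s] ++ tl) (2 * size s + i)%N = nth 0 tl i.
Proof.
elim: s => [|x s <-]; first by rewrite muln0.
by rewrite [size _]/= mulnS -addnA addSn addSn add0n.
Qed.

Lemma input_weight r (j : 'I_n) : layout r (1 + 2 * j)%N = weight j.
Proof.
rewrite /layout /E size_encode ifT; last by have := ltn_ord j; rewrite -/n; lia.
rewrite /encode add1n /=; have jn : (j < size (enum 'I_n))%N by rewrite size_enum_ord.
by rewrite (proj1 (nth_pairs j (@weight I) (@prob I) _ jn)) nth_ord_enum.
Qed.

Lemma input_prob r (j : 'I_n) : layout r (2 + 2 * j)%N = prob j.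
Proof.
rewrite /layout /E size_encode ifT; last by have := ltn_ord j; rewrite -/n; lia.
rewrite /encode add2n /=; have jn : (j < size (enum 'I_n))%N by rewrite size_enum_ord.
by rewrite (proj2 (nth_pairs j (@weight I) (@prob I) _ jn)) nth_ord_enum.
Qed.

Lemma input_m r : layout r (1 + 2 * n)%N = (size (patience I))%:R.
Proof.
rewrite /layout /E size_encode ifT; last by rewrite -/n; lia.
rewrite /encode add1n /= -[n in (2 * n)%N]size_enum_ord -[(2 * _)%N]addn0.
by rewrite (nth_pairs_tail (@weight I) (@prob I)).
Qed.

Lemma input_patience r i : (i < size (patience I))%N ->
  layout r (2 + 2 * n + 2 * i)%N = (nth (0%N, 0) (patience I) i).1%:R /\
  layout r (3 + 2 * n + 2 * i)%N = (nth (0%N, 0) (patience I) i).2.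
Proof.
move=> im; rewrite /layout /E size_encode !ifT; try by rewrite -/n; lia.
have tail k : nth 0 (encode I) (2 + 2 * n + k)%N =
    nth 0 (flatten [seq [:: t.1%:R; t.2] | t <- patience I] ++ [::]) k.
  rewrite cats0 /encode add2n addSn addSn /= -[n in (2 * n)%N]size_enum_ord -addnS.
  by rewrite (nth_pairs_tail (@weight I) (@prob I)).
have -> : (3 + 2 * n + 2 * i = 2 + 2 * n + (2 * i).+1)%N by lia.
rewrite !tail.
exact: (nth_pairs (0%N, 0) (fun t : nat * rat => t.1%:R) (fun t => t.2) [::] im).
Qed.

(** * Values of the program's expressions in a laid-out memory *)

Section Evaluation.
Variable r : regs.
Let ev := eval (layout r).

Lemma ev_bin o e1 e2 : ev (Bin o e1 e2) = eval_bin o (ev e1) (ev e2).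
Proof. by []. Qed.

Lemma ev_natD e1 e2 k1 k2 :
  ev e1 = k1%:R -> ev e2 = k2%:R -> ev (Bin Add e1 e2) = (k1 + k2)%N%:R.
Proof. by move=> h1 h2; rewrite /ev /= -/(ev e1) -/(ev e2) h1 h2 natrD. Qed.

Lemma ev_natM e1 e2 k1 k2 :
  ev e1 = k1%:R -> ev e2 = k2%:R -> ev (Bin Mul e1 e2) = (k1 * k2)%N%:R.
Proof. by move=> h1 h2; rewrite /ev /= -/(ev e1) -/(ev e2) h1 h2 natrM. Qed.

Lemma ev_lit k : ev (lit k) = k%:R. Proof. by []. Qed.

Lemma ev_read e k : ev e = k%:R -> ev (Read e) = layout r k.
Proof. by move=> h; rewrite /ev /= -/(ev e) h natrK. Qed.

Lemma ev_n : ev nE = n%:R.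
Proof. by rewrite (ev_read (ev_lit 0)). Qed.

Lemma ev_m : ev mE = (size (patience I))%:R.
Proof.
by rewrite (ev_read (ev_natD (ev_lit 1) (ev_natM (ev_lit 2) ev_n))) input_m.
Qed.

Lemma ev_slot e k : ev e = k%:R -> ev (slot e) = (E + k)%N%:R.
Proof.
have h2 := ev_lit 2.
move=> h; rewrite (ev_natD (ev_natD (ev_natD (ev_natM h2 ev_n) (ev_natM h2 ev_m)) h2) h).
by rewrite /E size_encode.
Qed.

Lemma ev_reg k : ev (reg k) = scratch r k.
Proof. by rewrite (ev_read (ev_slot (ev_lit k))) layout_scratch. Qed.

Lemma ev_lam_at e j : ev e = j%:R -> ev (lam_at e) = (E + (7 + 2 * j))%N%:R.
Proof. by move=> h; apply: ev_slot; apply: ev_natD (ev_natM (ev_lit 2) h). Qed.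

Lemma ev_stamp_at e j : ev e = j%:R -> ev (stamp_at e) = (E + (8 + 2 * j))%N%:R.
Proof. by move=> h; apply: ev_slot; apply: ev_natD (ev_natM (ev_lit 2) h). Qed.

Lemma scratch_lam j : scratch r (7 + 2 * j)%N = r_lam r j.
Proof. by rewrite /= mul2n odd_double doubleK. Qed.

Lemma scratch_stamp j : scratch r (8 + 2 * j)%N = r_stamp r j.
Proof. by rewrite /= mul2n odd_double /= uphalf_double. Qed.

Lemma ev_lam e j : ev e = j%:R -> ev (Read (lam_at e)) = r_lam r j.
Proof. by move=> h; rewrite (ev_read (ev_lam_at h)) layout_scratch scratch_lam. Qed.

Lemma ev_stamp e j : ev e = j%:R -> ev (Read (stamp_at e)) = r_stamp r j.
Proof. by move=> h; rewrite (ev_read (ev_stamp_at h)) layout_scratch scratch_stamp. Qed.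

Lemma ev_weight e (j : 'I_n) : ev e = j%:R -> ev (weightE e) = weight j.
Proof.
move=> h; rewrite (ev_read (ev_natD (ev_lit 1) (ev_natM (ev_lit 2) h))).
exact: input_weight.
Qed.

Lemma ev_prob e (j : 'I_n) : ev e = j%:R -> ev (probE e) = prob j.
Proof.
move=> h; rewrite (ev_read (ev_natD (ev_lit 2) (ev_natM (ev_lit 2) h))).
exact: input_prob.
Qed.

Lemma ev_theta e i : (i < size (patience I))%N -> ev e = i%:R ->
  ev (thetaE e) = (nth (0%N, 0) (patience I) i).1%:R.
Proof.
move=> im h; have h2 := ev_lit 2.
rewrite (ev_read (ev_natD (ev_natD h2 (ev_natM h2 ev_n)) (ev_natM h2 h))).
by have [] := input_patience r im.
Qed.

Lemma ev_mass e i : (i < size (patience I))%N -> ev e = i%:R ->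
  ev (massE e) = (nth (0%N, 0) (patience I) i).2.
Proof.
move=> im h; have h2 := ev_lit 2.
rewrite (ev_read (ev_natD (ev_natD (ev_lit 3) (ev_natM h2 ev_n)) (ev_natM h2 h))).
by have [] := input_patience r im.
Qed.

Lemma ev_gain (j : 'I_n) a : r_item r = j -> r_surv r = survival I a ->
  ev gainE = gain a (r_total r) (r_lam r) j.
Proof.
move=> rj rq; have h : ev (reg 2) = j%:R by rewrite ev_reg /= rj.
rewrite /gainE !ev_bin (ev_prob h) (ev_weight h) (ev_lam h) !ev_reg /=.
by rewrite rq.
Qed.

End Evaluation.

(** * Weakest preconditions with a time bound *)

Let B := bit_bound L.

Definition bounded (r : regs) : Prop := forall a, (bitsize (scratch r a) <= B)%N.

Lemma bounded_layout r : bounded r -> forall a, (bitsize (layout r a) <= B)%N.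
Proof.
move=> rB a; rewrite /layout; case: ltnP => // aE.
by apply: bits_input; apply: mem_nth.
Qed.

Lemma B_gt0 : (0 < B)%N. Proof. by rewrite /B /bit_bound addn2. Qed.

(* Times are measured in units of [B], the largest size of a memory cell. *)
Definition takes_time (c : cmd) r ps r' ps' (T : nat) : Prop :=
  forall t, exists2 t', (t' <= T * B + t)%N &
    runs c (State (layout r) ps t) (State (layout r') ps' t').

(** Total correctness with two bounds: the time is within [ccost] for [L] iterations per loop, and
    all cells keep to [B] bits, on which the cost of the next command relies. *)
Definition wp (c : cmd) (Q : regs -> seq nat -> Prop) r ps : Prop :=
  bounded r -> exists r' ps',
    [/\ takes_time c r ps r' ps' (ccost c).[L], bounded r' & Q r' ps'].

Lemma wp_mono (c : cmd) (Q Q' : regs -> seq nat -> Prop) r ps :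
  (forall r ps, Q r ps -> Q' r ps) -> wp c Q r ps -> wp c Q' r ps.
Proof.
by move=> QQ' W /W[r' [ps' [s1 s2 s3]]]; exists r', ps'; split=> //; apply: QQ'.
Qed.

Lemma wp_skip Q r ps : Q r ps -> wp Skip Q r ps.
Proof.
move=> q rB; exists r, ps; split=> // t; exists t; first exact: leq_addl.
exact: runs_skip.
Qed.

Lemma wp_store a r' ea ev Q r ps :
  eval (layout r) ea = (E + a)%N%:R ->
  update (scratch r) a (eval (layout r) ev) =1 scratch r' ->
  div_free ea -> div_free ev -> (bitsize (eval (layout r) ev) <= B)%N ->
  Q r' ps -> wp (Store ea ev) Q r ps.
Proof.
move=> ha rr' dfa dfv vB q rB; exists r', ps; split=> // [t|x]; last first.
  by rewrite -rr' /update; case: ifP.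
have h := runs_store ea ev (State (layout r) ps t).
rewrite /= ha natrK (update_layout rr') in h.
econstructor; last exact: h.
rewrite [ccost _]/= hornerC mulnDl leq_add2r.
by rewrite leq_add // (cost_le B_gt0 (bounded_layout rB)).
Qed.

Lemma wp_probe e k Q r ps :
  eval (layout r) e = k%:R -> div_free e -> Q r (rcons ps k) ->
  wp (Probe e) Q r ps.
Proof.
move=> ek df q rB; exists r, (rcons ps k); split=> // t.
have h := runs_probe e (State (layout r) ps t).
rewrite /= ek natrK in h; econstructor; last exact: h.
rewrite [ccost _]/= hornerC leq_add2r.
exact: (cost_le B_gt0 (bounded_layout rB) df).
Qed.

Lemma wp_seq c1 c2 Q r ps : wp c1 (wp c2 Q) r ps -> wp (Seq c1 c2) Q r ps.
Proof.
move=> W1 rB; have [r1 [ps1 [s1 rB1 W2]]] := W1 rB.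
have [r2 [ps2 [s2 rB2 q]]] := W2 rB1; exists r2, ps2; split=> // t.
have [t1 t1le h1] := s1 t; have [t2 t2le h2] := s2 t1.
exists t2; last exact: runs_seq h1 h2.
by rewrite [ccost _]/= hornerD mulnDl; lia.
Qed.

Lemma wp_if e c1 c2 Q r ps :
  div_free e ->
  (eval (layout r) e != 0 -> wp c1 Q r ps) ->
  (eval (layout r) e = 0 -> wp c2 Q r ps) -> wp (If e c1 c2) Q r ps.
Proof.
move=> df W1 W2 rB.
have ce := cost_le B_gt0 (bounded_layout rB) df.
have [e0|e0] := eqVneq (eval (layout r) e) 0.
  have [r' [ps' [s rB' q]]] := W2 e0 rB; exists r', ps'; split=> // t.
  have [t' t'le h] := s (cost (layout r) e + t)%N; exists t'.
    by rewrite [ccost _]/= !hornerD hornerC !mulnDl; lia.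
  by apply: runs_if; rewrite e0 eqxx.
have [r' [ps' [s rB' q]]] := W1 e0 rB; exists r', ps'; split=> // t.
have [t' t'le h] := s (cost (layout r) e + t)%N; exists t'.
  by rewrite [ccost _]/= !hornerD hornerC !mulnDl; lia.
by apply: runs_if; rewrite e0.
Qed.

(** The invariant is indexed by the number of remaining iterations, which is also the value of the
    test. It starts at most [L], in agreement with the role of ['X] in [ccost]. *)
Lemma wp_while e c (Inv : nat -> regs -> seq nat -> Prop) k Q r ps :
  div_free e -> (k <= L)%N ->
  (forall i r ps, Inv i r ps -> eval (layout r) e = i%:R) ->
  (forall i r ps, Inv i.+1 r ps -> wp c (Inv i) r ps) ->
  (forall r ps, Inv 0 r ps -> Q r ps) ->
  Inv k r ps -> wp (While e c) Q r ps.
Proof.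
move=> df kL ei body post inv rB.
(* The induction needs the time for exactly [k] iterations; [k] is relaxed to [L] outside it. *)
suff [r' [ps' [s rB' q]]] : exists r' ps', [/\ takes_time (While e c) r ps r' ps'
    (k * (ecost e + (ccost c).[L]) + ecost e), bounded r' & Inv 0 r' ps'].
  exists r', ps'; split=> //; last exact: post.
  move=> t; have [t' t'le h] := s t; exists t' => //; apply: leq_trans t'le _.
  rewrite [ccost _]/= hornerD hornerM hornerX hornerD !hornerC.
  by rewrite leq_add2r leq_mul2r leq_add2r leq_mul2r kL !orbT.
elim: k r ps rB inv {kL} => [|k IH] r ps rB inv.
  exists r, ps; split=> // t; exists (cost (layout r) e + t)%N.
    by rewrite mul0n add0n leq_add2r (cost_le B_gt0 (bounded_layout rB) df).
  by apply: runs_while_stop; apply: ei inv.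
have [r1 [ps1 [s1 rB1 inv1]]] := body _ _ _ inv rB.
have [r2 [ps2 [s2 rB2 inv2]]] := IH _ _ rB1 inv1; exists r2, ps2; split=> // t.
have [t1 t1le h1] := s1 (cost (layout r) e + t)%N; have [t2 t2le h2] := s2 t1.
exists t2; last first.
  apply: (runs_while_loop (s := State (layout r) ps t) _ h1 h2).
  by rewrite /= (ei _ _ _ inv) pnatr_eq0.
have := cost_le B_gt0 (bounded_layout rB) df.
rewrite mulSn !mulnDl in t2le *; lia.
Qed.

Lemma wp_set_reg k r' e Q r ps :
  update (scratch r) k (eval (layout r) e) =1 scratch r' ->
  div_free e -> (bitsize (eval (layout r) e) <= B)%N ->
  Q r' ps -> wp (set_reg k e) Q r ps.
Proof. by move=> rr' df vB q; apply: (wp_store (ev_slot (ev_lit r k)) rr'). Qed.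

Lemma bits_pred r k i : scratch r k = i.+1%:R -> (i <= L)%N ->
  eval (layout r) (Bin Defs.Sub (reg k) (lit 1)) = i%:R /\
  (bitsize (eval (layout r) (Bin Defs.Sub (reg k) (lit 1))) <= B)%N.
Proof.
move=> rk iL; rewrite ev_bin ev_reg rk ev_lit /= -natrB // subn1.
by split=> //; apply: bits_nat.
Qed.

End Layout.

Lemma update_lam th U j g b q i lam st k v :
  update (scratch (Regs th U j g b q i lam st)) (7 + 2 * k)%N v =1
  scratch (Regs th U j g b q i (update lam k v) st).
Proof.
case=> [|[|[|[|[|[|[|a]]]]]]] //; rewrite /update [scratch _ _]/= [RHS]/=.
have -> : (a.+4.+3 == 7 + 2 * k)%N = ~~ odd a && (a./2 == k) by lia.
by case: (odd a).
Qed.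

Lemma update_stamp th U j g b q i lam st k v :
  update (scratch (Regs th U j g b q i lam st)) (8 + 2 * k)%N v =1
  scratch (Regs th U j g b q i lam (update st k v)).
Proof.
case=> [|[|[|[|[|[|[|a]]]]]]] //; rewrite /update [scratch _ _]/= [RHS]/=.
have -> : (a.+4.+3 == 8 + 2 * k)%N = odd a && (a./2 == k) by lia.
by case: (odd a).
Qed.

(** * Correctness of the program *)

Lemma wp_countdown I k c (Inv : nat -> regs -> seq nat -> Prop) m Q r ps :
  (m <= input_size I)%N ->
  (forall i r ps, Inv i r ps -> scratch r k = i%:R) ->
  (forall i r ps, Inv i.+1 r ps -> exists2 r',
     update (scratch r) k i%:R =1 scratch r' & wp I c (Inv i) r' ps) ->
  (forall r ps, Inv 0 r ps -> Q r ps) ->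
  Inv m r ps -> wp I (countdown k c) Q r ps.
Proof.
move=> mL rk body post inv.
(* Keeping [i <= m] bounds the bit size of the decremented counter. *)
pose Inv' i r ps := Inv i r ps /\ (i <= m)%N.
apply: (wp_while (Inv := Inv') (k := m)) => //.
- by move=> i r1 ps1 [/rk h _]; rewrite ev_reg.
- move=> i r1 ps1 [inv1 im]; have [r2 r12 W] := body _ _ _ inv1.
  have [e1 e2] := bits_pred (rk _ _ _ inv1) (leq_trans (ltnW im) mL).
  apply: wp_seq; apply: wp_set_reg e2 _ => //; first by rewrite e1; exact: r12.
  by apply: wp_mono W => r3 ps3; split=> //; apply: ltnW.
- by move=> r1 ps1 [/post].
Qed.

Section Correctness.
Variable I : instance.
Let n := nvert I.

Lemma wp_survival_loop th U j g b lam st Q ps :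
  Q (Regs th U j g b (survival I th) 0 lam st) ps ->
  wp I survival_loop Q (Regs th U j g b 0 (size (patience I)) lam st) ps.
Proof.
move=> q.
(* Rows are added from the last to the first, so the accumulator is a tail sum. *)
pose Inv i r ps' := [/\ (i <= size (patience I))%N,
  r = Regs th U j g b (tail_sum I th i) i lam st & ps' = ps].
apply: (wp_countdown (Inv := Inv)) (size_patience_le I) _ _ _ _.
- by move=> i r ps' [_ ->].
- move=> i _ _ [im -> ->]; exists (Regs th U j g b (tail_sum I th i.+1) i lam st).
    by do 7!case=> //.
  set r := Regs _ _ _ _ _ _ _ _ _.
  have ei : eval (layout I r) (reg 6) = i%:R by rewrite ev_reg.
  have tailE : tail_sum I th i =
      (if (th <= (nth (0%N, 0 : rat) (patience I) i).1)%N
       then (nth (0%N, 0 : rat) (patience I) i).2 else 0) + tail_sum I th i.+1.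
    rewrite /tail_sum (drop_nth (0%N, 0 : rat)) // big_cons.
    by case: ifP => _; rewrite ?add0r.
  have ec : eval (layout I r) (Bin Leq (reg 0) (thetaE (reg 6))) =
      (th <= (nth (0%N, 0 : rat) (patience I) i).1)%N%:R.
    by rewrite ev_bin (ev_theta im ei) ev_reg /= ler_nat.
  apply: wp_if => //; rewrite ec.
    rewrite pnatr_eq0 eqb0 negbK => c; rewrite c in tailE.
    have ev : eval (layout I r) (Bin Add (reg 5) (massE (reg 6))) = tail_sum I th i.
      by rewrite ev_bin (ev_mass im ei) ev_reg /= addrC tailE.
    apply: (@wp_set_reg _ 5 (Regs th U j g b (tail_sum I th i) i lam st)) => //.
    + by rewrite ev; do 7!case=> //.
    + by rewrite ev; apply: bits_tail_sum.
    + by split=> //; apply: ltnW.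
  case: ifP tailE => // _; rewrite add0r => tailE _.
  by apply: wp_skip; split; rewrite ?tailE // ltnW.
- by move=> r ps' [_ -> ->]; rewrite /tail_sum drop0.
- by split=> //; rewrite /tail_sum drop_size big_nil.
Qed.

Lemma wp_best_loop th U b lam st row th' st' (l : seq 'I_n) Q ps :
  greedy th' U lam st' l ->
  (forall g (b : nat),
     (forall j : 'I_n, gain th U lam j <= g) ->
     g = 0 \/ (0 < g /\ exists2 j : 'I_n, b = j & g = gain th U lam j) ->
     Q (Regs th U 0 g b (survival I th) row lam st) ps) ->
  wp I best_loop Q (Regs th U n 0 b (survival I th) row lam st) ps.
Proof.
move=> G post.
(* The items from [i] on have been examined; [g] is 0 if none has a positive gain, and otherwise
   their largest gain. *)
pose Inv i r ps' := exists g (b : nat),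
  [/\ (i <= n)%N, r = Regs th U i g b (survival I th) row lam st, ps' = ps,
      forall j : 'I_n, (i <= j)%N -> gain th U lam j <= g
    & g = 0 \/ (0 < g /\ exists2 j : 'I_n, b = j & g = gain th U lam j)].
apply: (wp_countdown (Inv := Inv)) (nvert_le I) _ _ _ _.
- by move=> i r ps' [g [c [_ ->]]].
- move=> i _ _ [g [c [iN -> -> gmax gc]]].
  set r := Regs th U i g c (survival I th) row lam st.
  exists r; first by do 7!case=> //.
  pose j := Ordinal iN.
  have g0 : 0 <= g by case: gc => [->|[/ltW]].
  have eg : eval (layout I r) gainE = gain th U lam j by exact: ev_gain.
  apply: wp_if => //; rewrite ev_bin eg ev_reg /=.
    rewrite pnatr_eq0 eqb0 => /negPn le_g; apply: wp_skip.
    exists g, c; split=> //; first exact: ltnW.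
    move=> j' ij'; have [jj|/gmax //] := leqP j' i.
    by have -> : j' = j by apply: val_inj => /=; lia.
  move/eqP; rewrite pnatr_eq0 eqb0 -ltNge => lt_g.
  apply: wp_seq; apply: (@wp_set_reg _ 3
    (Regs th U i (gain th U lam j) c (survival I th) row lam st)) => //.
  + by rewrite eg; do 7!case=> //.
  + by rewrite eg; apply: bits_gain G _; apply: ltW; apply: le_lt_trans lt_g.
  apply: (@wp_set_reg _ 4
    (Regs th U i (gain th U lam j) i (survival I th) row lam st)) => //.
  + by rewrite ev_reg; do 7!case=> //.
  + by rewrite ev_reg; apply: bits_nat; apply: leq_trans (ltnW iN) (nvert_le I).
  exists (gain th U lam j), i; split=> //; first exact: ltnW.
    move=> j' ij'; have [jj|/gmax h] := leqP j' i.
      by have -> : j' = j by apply: val_inj => /=; lia.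
    exact: le_trans h (ltW lt_g).
  right; split; first exact: le_lt_trans lt_g.
  by exists j.
- by move=> r ps' [g [c [_ -> -> gmax gc]]]; apply: post => // j; apply: gmax.
- exists 0, b; split=> //; last by left.
  by move=> j; rewrite leqNgt ltn_ord.
Qed.

Lemma wp_plan_step th r (l : seq 'I_n) Q ps :
  r_pos r = th.+1 -> greedy th.+1 (r_total r) (r_lam r) (r_stamp r) l ->
  (forall r' (l' : seq 'I_n), r_pos r' = th ->
     greedy th (r_total r') (r_lam r') (r_stamp r') l' -> Q r' ps) ->
  wp I plan_step Q r ps.
Proof.
case: r => _ U j g b q row lam st /= -> G post.
have thn : (th < n)%N by apply: greedy_leq G.
have nL := nvert_le I; have mL := size_patience_le I.
apply: wp_seq; apply: (@wp_set_reg _ 5 (Regs th.+1 U j g b 0 row lam st)) => //.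
- by do 7!case=> //.
- exact: (@bits_nat I 0).
apply: wp_seq.
apply: (@wp_set_reg _ 6 (Regs th.+1 U j g b 0 (size (patience I)) lam st)) => //.
- by rewrite ev_m; do 7!case=> //.
- by rewrite ev_m; apply: bits_nat.
apply: wp_seq; apply: wp_survival_loop.
apply: wp_seq.
apply: (@wp_set_reg _ 3 (Regs th.+1 U j 0 b (survival I th.+1) 0 lam st)) => //.
- by do 7!case=> //.
- exact: (@bits_nat I 0).
apply: wp_seq.
apply: (@wp_set_reg _ 2 (Regs th.+1 U n 0 b (survival I th.+1) 0 lam st)) => //.
- by rewrite ev_n; do 7!case=> //.
- by rewrite ev_n; apply: bits_nat.
apply: wp_seq; apply: (wp_best_loop G) => {}g {}b gmax gb.
(* Both branches end by lowering register 0 in a memory that holds the next greedy state. *)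
have dec U' lam' st' (l' : seq 'I_n) : greedy th U' lam' st' l' ->
    wp I (decr 0) Q (Regs th.+1 U' 0 g b (survival I th.+1) 0 lam' st') ps.
  move=> G'; set r := Regs _ _ _ _ _ _ _ _ _.
  have [e1 e2] := @bits_pred I r 0 th erefl (leq_trans (ltnW thn) nL).
  apply: (@wp_set_reg _ 0 (Regs th U' 0 g b (survival I th.+1) 0 lam' st')) => //.
  - by rewrite e1; do 7!case=> //.
  - by apply: (post _ l').
apply: wp_seq; apply: wp_if => //; rewrite ev_reg /=; last first.
  by move=> g0; apply: wp_skip; apply: dec (greedy_keep G _); rewrite -g0.
case: gb => [->|[g0 [jb bj gj]] _]; first by rewrite eqxx.
rewrite bj {b bj} in dec *.
(* Obtained before the stores, because the sizes of the new price and total are bounded through this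
   state. *)
have G' : greedy th (U + g) (update lam jb (lam jb + g))
    (update st jb (n - th)%:R) (jb :: [seq j <- l | j != jb]).
  by rewrite gj; apply: greedy_take G _ _; rewrite -gj.
apply: wp_seq; set r1 := Regs _ _ _ _ _ _ _ _ _.
have e4 : eval (layout I r1) (reg 4) = jb%:R by rewrite ev_reg.
have el : eval (layout I r1) (Bin Add (Read (lam_at (reg 4))) (reg 3)) = lam jb + g.
  by rewrite ev_bin (ev_lam e4) ev_reg.
set lam' := update lam jb (lam jb + g) in G' *.
apply: (wp_store (r' := Regs th.+1 U 0 g jb (survival I th.+1) 0 lam' st)
  (ev_lam_at e4)) => //.
- by rewrite el; apply: update_lam.
- have := bits_lam G' jb; rewrite el /lam' /update eqxx //.
apply: wp_seq; set r2 := Regs _ _ _ _ _ _ _ _ _.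
have e4' : eval (layout I r2) (reg 4) = jb%:R by rewrite ev_reg.
have es : eval (layout I r2) (Bin Defs.Sub (Bin Add nE (lit 1)) (reg 0)) = (n - th)%:R.
  rewrite !ev_bin ev_n ev_reg ev_lit /= natrB ?(ltnW thn) // -[th.+1]addn1 natrD.
  by rewrite opprD addrACA subrr addr0.
apply: (wp_store (r' := Regs th.+1 U 0 g jb (survival I th.+1) 0 lam'
  (update st jb (n - th)%:R)) (ev_stamp_at e4')) => //.
- by rewrite es; apply: update_stamp.
- by rewrite es; apply: bits_nat; apply: leq_trans nL; apply: leq_subr.
set r3 := Regs _ _ _ _ _ _ _ _ _.
have eU : eval (layout I r3) (Bin Add (reg 1) (reg 3)) = U + g.
  by rewrite ev_bin !ev_reg.
apply: (@wp_set_reg _ 1 (Regs th.+1 (U + g) 0 g jb (survival I th.+1) 0 lam'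
  (update st jb (n - th)%:R))) => //.
- by rewrite eU; do 7!case=> //.
- by rewrite eU; apply: bits_U G'.
- exact: dec G'.
Qed.

Lemma wp_probe_loop k U g b q row lam st Q ps :
  Q (Regs k U 0 g b q row lam st)
    (ps ++ map val [seq j : 'I_n <- rev (enum 'I_n) | st j == k%:R]) ->
  wp I probe_loop Q (Regs k U n g b q row lam st) ps.
Proof.
move=> post.
(* Counting down visits the items in decreasing order, as in [schedule]. *)
pose Inv i r ps' := [/\ (i <= n)%N, r = Regs k U i g b q row lam st
  & ps' = ps ++ [seq j <- rev (iota i (n - i)) | st j == k%:R]].
apply: (wp_countdown (Inv := Inv)) (nvert_le I) _ _ _ _.
- by move=> i r ps' [_ ->].
- move=> i _ _ [iN -> ->].
  set r := Regs k U i g b q row lam st; exists r; first by do 7!case=> //.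
  have e2 : eval (layout I r) (reg 2) = i%:R by rewrite ev_reg.
  have iotaE : iota i (n - i) = i :: iota i.+1 (n - i.+1).
    by rewrite -/(iota i _.+1); congr iota; lia.
  apply: wp_if => //; rewrite ev_bin (ev_stamp e2) ev_reg /=.
    rewrite subr_eq0 => /negPf sk; apply: wp_skip; split=> //; first exact: ltnW.
    by rewrite iotaE rev_cons filter_rcons sk.
  move/eqP; rewrite subr_eq0 => sk; apply: (wp_probe e2) => //.
  split=> //; first exact: ltnW.
  by rewrite iotaE rev_cons filter_rcons sk rcons_cat.
- move=> r ps' [_ -> ->]; rewrite subn0 -val_enum_ord -map_rev filter_map.
  exact: post.
- by split=> //; rewrite subnn cats0.
Qed.

Lemma wp_greedy_program :
  wp I greedy_program
    (fun _ ps => exists U lam st (l : seq 'I_n), greedy 0 U lam st l /\ ps = map val l)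
    (Regs 0 0 0 0 0 0 0 (fun=> 0) (fun=> 0)) [::].
Proof.
have nL := nvert_le I.
apply: wp_seq; apply: (@wp_set_reg _ 0 (Regs n 0 0 0 0 0 0 (fun=> 0) (fun=> 0))) => //.
- by rewrite ev_n; do 7!case=> //.
- by rewrite ev_n; apply: bits_nat.
pose Plan i r (ps : seq nat) := [/\ r_pos r = i, ps = [::]
  & exists l : seq 'I_n, greedy i (r_total r) (r_lam r) (r_stamp r) l].
apply: wp_seq; apply: (wp_while (Inv := Plan) (k := n)) => //.
- by move=> i r ps [<- _ _]; rewrite ev_reg; case: r.
- move=> i r _ [ri -> [l G]]; apply: wp_plan_step ri G _ => r' l' ri' G'.
  by split=> //; exists l'.
- move=> [_ U j g b q row lam st] _ [/= -> -> [l G]].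
  apply: wp_seq; apply: (@wp_set_reg _ 0 (Regs n U j g b q row lam st)) => //.
  + by rewrite ev_n; do 7!case=> //.
  + by rewrite ev_n; apply: bits_nat.
  (* The probes made and the levels still to be scanned form the full schedule, so all of it is
     probed once [i] is 0. *)
  pose Probing i r ps := exists (j g b q row : _),
    [/\ (i <= n)%N, r = Regs i U j g b q row lam st
      & map val (schedule I st n) = ps ++ map val (schedule I st i)].
  apply: (wp_while (Inv := Probing) (k := n)) => //.
  + by move=> i r ps [? [? [? [? [? [_ -> _]]]]]]; rewrite ev_reg.
  + move=> i _ ps [{}j [{}g [{}b [{}q [{}row [iN -> schedE]]]]]].
    apply: wp_seq; apply: (@wp_set_reg _ 2 (Regs i.+1 U n g b q row lam st)) => //.
    * by rewrite ev_n; do 7!case=> //.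
    * by rewrite ev_n; apply: bits_nat.
    apply: wp_seq; apply: wp_probe_loop; set r := Regs _ _ _ _ _ _ _ _ _.
    have [e1 e2] := @bits_pred I r 0 i erefl (leq_trans (ltnW iN) nL).
    apply: (@wp_set_reg _ 0 (Regs i U 0 g b q row lam st)) => //.
    * by rewrite e1; do 7!case=> //.
    exists 0%N, g, b, q, row; split=> //; first exact: ltnW.
    by rewrite schedE /= map_cat catA.
  + move=> r ps [? [? [? [? [? [_ _ schedE]]]]]]; exists U, lam, st, l; split=> //.
    by move: schedE; rewrite cats0 -(greedy_schedule G) subn0 => ->.
  + by exists j, g, b, q, row; split.
- by split=> //; exists [::]; apply: greedy_start.
Qed.

End Correctness.

Theorem theorem1 :
  exists (alg : cmd) (P : {poly nat}),
    forall I : instance,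
      exists k : nat,
        proper_run I P.[input_size I] (run_on k alg I)
        /\ forall (R : realFieldType) (pi : policy R (nvert I)),
             valid_policy pi ->
             2^-1 * reward I pi <= run_reward R I (run_on k alg I).
Proof.
(* [bit_bound] as a polynomial; it is the time unit of [takes_time]. *)
pose bound : {poly nat} := 2%:P * 'X * 'X + 8%:P * 'X + 2%:P.
exists greedy_program, (ccost greedy_program * bound) => I.
have bounded0 : bounded I (Regs 0 0 0 0 0 0 0 (fun=> 0) (fun=> 0)).
  have b0 : (bitsize 0 <= bit_bound (input_size I))%N by apply: (@bits_nat I 0).
  by move=> [|[|[|[|[|[|[|a]]]]]]] //=; case: ifP.
have [r [ps [time_le _ [U [lam [st [l [G psE]]]]]]]] := wp_greedy_program bounded0.
rewrite {ps}psE in time_le.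
have [t tle [k runE]] := time_le 0%N; exists k.
(* The program draws no samples, so its run has a single outcome, of probability 1. *)
have := runE k (leqnn k); rewrite -layout_start.
rewrite -[State _ _ _]/(start I) -/(run_on k greedy_program I) => ->.
split=> [|R pi pi_valid].
  rewrite /proper_run /= andbT; apply/and3P; split.
  - apply: leq_trans tle _; rewrite addn0 hornerM.
    by rewrite /bound !hornerD !hornerM !hornerC hornerX.
  - by rewrite map_inj_uniq ?(greedy_uniq G) //; apply: val_inj.
  - by apply/allP => _ /mapP[j _ ->].
rewrite /run_reward big_seq1 /= rmorph1 mul1r reward_order_policy.
apply: le_trans (greedy_reward_le pi_valid G) _.
by rewrite ler_rat (greedy_value G).
Qed.
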